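(* Let $4\le d\le m$. A $3$-way $d$-homogeneous $(3m,3,2)$ Steiner trade exists in each of the following cases: (a) $d=4$, except possibly for $m=6,7,11$; (b) $d=5$, except possibly for $m=6$; (c) $6\le d\le 13$; (d) $d=15$; (e) $m\ge d^2$; (f) $m\equiv 0 \pmod 5$, except possibly for $m=30$; (g) $m\equiv 0\pmod 7$, except possibly for $m=7$ (where $d=4$) and $m=42$.
   Context: Let $V$ be a finite set with $v$ elements and let $t<k<v$ be positive integers. A $\mu$-way $(v,k,t)$ trade $T=\{T_1,\dots,T_\mu\}$ of volume $m'$ consists of $\mu$ pairwise disjoint collections $T_1,\dots,T_\mu$, each of $m'$ blocks ($k$-subsets of $V$), such that every $t$-subset of $V$ is contained in the same number of blocks in each $T_i$. The foundation $\mathrm{found}(T)$ is the set of elements covered by the blocks. It is a Steiner trade if every $t$-subset of $\mathrm{found}(T)$ is in at most one block of each $T_i$, and $d$-homogeneous if every element of $V$ lies in exactly $d$ blocks of each $T_i$. *)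

(* Defs.v *)
From mathcomp Require Import all_boot.

Set Implicit Arguments.
Unset Strict Implicit.
Unset Printing Implicit Defensive.

Section Trades.
Variables (V : finType) (mu : nat) (T : 'I_mu -> {set {set V}}).

Definition blocks_through (i : 'I_mu) (S : {set V}) : {set {set V}} :=
  [set B in T i | S \subset B].

Definition found : {set V} := \bigcup_(i < mu) cover (T i).

Record trade (v k t vol : nat) : Prop := Trade {
  trade_params : [/\ 0 < t, t < k & k < v];
  trade_points : #|V| = v;
  trade_volume : forall i, #|T i| = vol;
  trade_blocks : forall i (B : {set V}), B \in T i -> #|B| = k;
  trade_disjoint : forall i j, i != j -> [disjoint T i & T j];
  trade_balanced : forall S : {set V}, #|S| = t ->
    forall i j, #|blocks_through i S| = #|blocks_through j S| }.

Definition steiner_trade (v k t vol : nat) : Prop :=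
  trade v k t vol /\
  forall S : {set V}, S \subset found -> #|S| = t ->
    forall i, #|blocks_through i S| <= 1.

(* The points range over the whole of V, not only over found. *)
Definition homogeneous (d : nat) : Prop :=
  forall (x : V) (i : 'I_mu), #|[set B in T i | x \in B]| = d.

End Trades.

(* Main.v *)
Require Import Defs.
From mathcomp Require Import all_boot all_algebra all_field zify.

(* Points are arranged in three groups 'I_3 x A, and blocks are transversals, i.e.
   functions 'I_3 -> A; the trade becomes a 3-way d-homogeneous Latin trade of
   order m = #|A|.  Such trades come from Latin squares (d = m), from base rows
   developed over Z_m (finitely many of them handle 6 <= d <= 13 and d = 15, and a
   few orders for d = 4, 5), from disjoint unions (orders add), and from a product:
   given a Latin square on G with an orthogonal mate, replacing each cell whose mate
   entry is a by a trade of degree d_a and order M yields degree \sum_a d_a and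
   order #|G| M.
   Taking G = Z_o with o odd, or G = F_4, the degrees 4, 5 (order 5) and 5, 6, 7
   (order 7) together with orders 10 and 14 give every d >= 14 for every multiple
   of 5 or 7.  Finally, if m >= d^2 and d >= 14 then m = 5 x + 7 y with both
   summands at least d. *)

Set Implicit Arguments.
Unset Strict Implicit.
Unset Printing Implicit Defensive.
Import GRing.Theory.

(** * Latin trades and relabelling of their points *)

(** Balance asks only for existence: by [latin_determined] two coordinate values lie in at most one
    block of each [T i], so equal counts amount to this. *)
Record latin_trade (A : finType) (d : nat)
    (T : 'I_3 -> {set {ffun 'I_3 -> A}}) : Prop := LatinTrade {
  latin_determined : forall i p q f g, p != q -> f \in T i -> g \in T i ->
    f p = g p -> f q = g q -> f = g;
  latin_balanced : forall i j p q f, p != q -> f \in T i ->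
    exists g, [/\ g \in T j, g p = f p & g q = f q];
  latin_disjoint : forall i j f, f \in T i -> f \in T j -> i = j;
  latin_degree : forall i p a, #|[set f in T i | f p == a]| = d }.

Definition has_latin_trade (d m : nat) : Prop :=
  exists T : 'I_3 -> {set {ffun 'I_3 -> 'I_m}}, latin_trade d T.

Lemma eq_card_bijection (A B : finType) :
  #|A| = #|B| -> exists2 h : A -> B, injective h & exists2 k, cancel h k & cancel k h.
Proof.
move=> E; pose h a : B := enum_val (cast_ord E (enum_rank a)).
pose k b : A := enum_val (cast_ord (esym E) (enum_rank b)).
have hK : cancel h k by move=> a; rewrite /h /k enum_valK cast_ordK enum_rankK.
have kK : cancel k h by move=> b; rewrite /h /k enum_valK cast_ordKV enum_rankK.
by exists h; [exact: can_inj hK | exists k].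
Qed.

(** Lets each construction work on its own point type (a sum, a product, a group) and return to an
    ordinal. *)
Lemma has_latin_trade_card (A : finType) (d : nat)
    (T : 'I_3 -> {set {ffun 'I_3 -> A}}) :
  latin_trade d T -> has_latin_trade d #|A|.
Proof.
move=> [det bal dis deg].
have [h hI [k hK kK]] := @eq_card_bijection A 'I_#|A| (esym (card_ord _)).
pose up (f : {ffun 'I_3 -> A}) := [ffun p => h (f p)].
have upI : injective up.
  by move=> f g /ffunP E; apply/ffunP=> p; move: (E p); rewrite !ffunE => /hI.
exists (fun i => up @: T i); split.
- move=> i p q f g pq /imsetP[f' f'T ->] /imsetP[g' g'T ->].
  by rewrite !ffunE => /hI Ep /hI Eq; rewrite (det i p q f' g').
- move=> i j p q f pq /imsetP[f' f'T ->].
  have [g [gT Ep Eq]] := bal i j p q f' pq f'T.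
  by exists (up g); rewrite imset_f // !ffunE Ep Eq.
- move=> i j f /imsetP[f' f'T ->] /imsetP[g' g'T /upI E].
  by apply: (dis i j f') => //; rewrite E.
- move=> i p a; rewrite -(deg i p (k a)) -(card_imset _ upI); apply: eq_card => f.
  rewrite !inE; apply/andP/imsetP.
    move=> [/imsetP[f' f'T ->]]; rewrite ffunE => /eqP <-.
    by exists f'; rewrite // inE f'T hK eqxx.
  by move=> [f']; rewrite inE => /andP[f'T /eqP E] ->; rewrite imset_f // ffunE E kK.
Qed.

Lemma ord3_sym_ind (p q : 'I_3) (P : 'I_3 -> 'I_3 -> Prop) :
  (forall p q, P p q -> P q p) ->
  P (inord 0) (inord 1) -> P (inord 0) (inord 2) -> P (inord 1) (inord 2) -> p != q -> P p q.
Proof.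
move=> sym P01 P02 P12.
have E (r : 'I_3) : [\/ r = inord 0, r = inord 1 | r = inord 2].
  rewrite -[r]inord_val; case: r => -[|[|[|]]] // ? /=;
  by [apply: Or31 | apply: Or32 | apply: Or33].
have [->|->|->] := E p; have [->|->|->] := E q; rewrite ?eqxx // => _; by apply: sym.
Qed.

Lemma latin_trade_card (A : finType) d (T : 'I_3 -> {set {ffun 'I_3 -> A}}) i :
  latin_trade d T -> #|T i| = #|A| * d.
Proof.
move=> [_ _ _ deg]; rewrite -sum1_card (partition_big (fun f : {ffun _} => f ord0) predT) //=.
rewrite -sum_nat_const; apply: eq_bigr => a _; rewrite -(deg i ord0 a) -sum1_card.
by apply: eq_bigl => f; rewrite inE.
Qed.

(** * From Latin trades to Steiner trades *)

Lemma latin_steiner_trade (d m : nat) (V : finType) :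
  1 < m -> #|V| = 3 * m -> has_latin_trade d m ->
  exists (vol : nat) (T : 'I_3 -> {set {set V}}),
    steiner_trade T (3 * m) 3 2 vol /\ homogeneous T d.
Proof.
move=> m1 cV [T LT]; have [det bal dis deg] := LT.
have [|h hI [k hK kK]] := @eq_card_bijection ('I_3 * 'I_m)%type V.
  by rewrite card_prod !card_ord.
have kI : injective k := can_inj kK.
(* [blk f] is the graph of [f], carried to [V] by [h]. *)
pose blk (f : {ffun 'I_3 -> 'I_m}) := [set v | f (k v).1 == (k v).2].
have blkI : injective blk.
  move=> f g /setP E; apply/ffunP=> p; move: (E (h (p, f p))).
  by rewrite !inE hK eqxx => /esym/eqP.
have determined (S : {set V}) i : #|S| = 2 -> #|blocks_through (fun i => blk @: T i) i S| <= 1.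
  move=> /eqP/cards2P[u [v [uv ->]]]; apply/card_le1_eqP => B B'.
  rewrite !inE => /andP[/imsetP[f fT ->]] + /andP[/imsetP[g gT ->]].
  rewrite !subUset !sub1set !inE => /andP[/eqP fu /eqP fv] /andP[/eqP gu /eqP gv].
  (* A graph meets each group once, so distinct points of a block lie in different groups. *)
  have pq : (k u).1 != (k v).1.
    apply: contraNneq uv => E; apply/eqP/kI.
    by rewrite [k u]surjective_pairing [k v]surjective_pairing -fu -fv E.
  by rewrite (det i _ _ f g pq) ?fu ?fv.
have nonempty (S : {set V}) i j : #|S| = 2 -> 0 < #|blocks_through (fun i => blk @: T i) i S| ->
    0 < #|blocks_through (fun i => blk @: T i) j S|.
  move=> /eqP/cards2P[u [v [uv ->]]] /card_gt0P[B].
  rewrite !inE => /andP[/imsetP[f fT ->]].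
  rewrite !subUset !sub1set !inE => /andP[/eqP fu /eqP fv].
  have pq : (k u).1 != (k v).1.
    apply: contraNneq uv => E; apply/eqP/kI.
    by rewrite [k u]surjective_pairing [k v]surjective_pairing -fu -fv E.
  have [g [gT Eu Ev]] := bal i j _ _ f pq fT.
  apply/card_gt0P; exists (blk g).
  by rewrite inE imset_f // subUset !sub1set !inE Eu Ev fu fv !eqxx.
exists (m * d), (fun i => blk @: T i); split; [split; first split|].
- by split=> //; lia.
- by [].
- by move=> i; rewrite card_imset // (latin_trade_card i LT) card_ord.
- move=> i B /imsetP[f fT ->].
  have <- : #|[set h (p, f p) | p : 'I_3]| = 3.
    by rewrite card_imset ?card_ord // => p q /hI[].
  apply: eq_card => v; rewrite inE; apply/eqP/imsetP.
    by move=> E; exists (k v).1; rewrite // E -surjective_pairing kK.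
  by move=> [p _ ->]; rewrite hK.
- move=> i j ij; rewrite -setI_eq0; apply: contraNT ij => /set0Pn[B].
  rewrite inE => /andP[/imsetP[f fT ->] /imsetP[g gT /blkI E]].
  by apply/eqP/(dis i j f); rewrite // E.
- move=> S cS i j.
  (* Both counts are at most 1, and they vanish together. *)
  have := determined S i cS; have := determined S j cS.
  have := nonempty S i j cS; have := nonempty S j i cS; lia.
- by move=> S _ cS i; apply: determined.
move=> x i; rewrite -(deg i (k x).1 (k x).2) -(card_imset _ blkI).
apply: eq_card => B; rewrite !inE; apply/andP/imsetP.
  by move=> [/imsetP[f fT ->]]; rewrite inE => fx; exists f; rewrite // inE fT.
by move=> [f]; rewrite inE => /andP[fT fx] ->; rewrite imset_f // inE.
Qed.

(** * The empty trade and disjoint unions *)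

Lemma has_latin_trade0 m : has_latin_trade 0 m.
Proof.
exists (fun=> set0); split=> [i p q f g _|i j p q f _|i j f|i p a]; rewrite ?inE //.
by apply: eq_card0 => f; rewrite !inE.
Qed.

Lemma has_latin_trade_sum d m n :
  has_latin_trade d m -> has_latin_trade d n -> has_latin_trade d (m + n).
Proof.
move=> [T [Tdet Tbal Tdis Tdeg]] [U [Udet Ubal Udis Udeg]].
pose l (f : {ffun 'I_3 -> 'I_m}) : {ffun 'I_3 -> 'I_m + 'I_n} := [ffun p => inl (f p)].
pose r (f : {ffun 'I_3 -> 'I_n}) : {ffun 'I_3 -> 'I_m + 'I_n} := [ffun p => inr (f p)].
have lI : injective l.
  by move=> f g /ffunP E; apply/ffunP=> p; move: (E p); rewrite !ffunE => -[].
have rI : injective r.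
  by move=> f g /ffunP E; apply/ffunP=> p; move: (E p); rewrite !ffunE => -[].
have lr f g : l f <> r g by move=> /ffunP/(_ ord0); rewrite !ffunE.
have -> : m + n = #|{: 'I_m + 'I_n}| by rewrite card_sum !card_ord.
apply: (@has_latin_trade_card _ _ (fun i => l @: T i :|: r @: U i)); split.
- move=> i p q f g pq /setUP[]/imsetP[f' fT ->] /setUP[]/imsetP[g' gT ->];
    rewrite !ffunE // => -[Ep] [Eq].
    by rewrite (Tdet i p q f' g').
  by rewrite (Udet i p q f' g').
- move=> i j p q f pq /setUP[]/imsetP[f' fT ->].
    have [g [gT Ep Eq]] := Tbal i j p q f' pq fT.
    by exists (l g); rewrite inE imset_f // !ffunE Ep Eq.
  have [g [gT Ep Eq]] := Ubal i j p q f' pq fT.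
  by exists (r g); rewrite inE [_ \in r @: _]imset_f ?orbT // !ffunE Ep Eq.
- move=> i j f /setUP[]/imsetP[f' fT ->] /setUP[]/imsetP[g gT].
  + by move=> /lI E; apply: (Tdis i j f'); rewrite // E.
  + by move=> /lr.
  + by move=> /esym/lr.
  + by move=> /rI E; apply: (Udis i j f'); rewrite // E.
- move=> i p [a|a].
    rewrite -(Tdeg i p a) -(card_imset _ lI); apply: eq_card => f; rewrite !inE.
    apply/andP/imsetP.
      move=> [/orP[]/imsetP[f' fT ->]]; rewrite ffunE // => /eqP[E].
      by exists f'; rewrite // inE fT E /=.
    by move=> [f']; rewrite inE => /andP[fT /eqP <-] ->; rewrite imset_f // ffunE.
  rewrite -(Udeg i p a) -(card_imset _ rI); apply: eq_card => f; rewrite !inE.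
  apply/andP/imsetP.
    move=> [/orP[]/imsetP[f' fT ->]]; rewrite ffunE // => /eqP[E].
    by exists f'; rewrite // inE fT E /=.
  by move=> [f']; rewrite inE => /andP[fT /eqP <-] ->; rewrite [_ \in r @: _]imset_f ?orbT // ffunE.
Qed.

(** * Base rows and pairs of coordinates *)

Lemma card_dep_pairs (X Y : finType) (P : X -> pred Y) :
  #|[set t : X * Y | P t.1 t.2]| = \sum_x #|[set y | P x y]|.
Proof.
transitivity (\sum_x \sum_(y | P x y) 1).
  by rewrite pair_big_dep -sum1_card; apply: eq_bigl => t; rewrite inE.
by apply: eq_bigr => x _; rewrite -sum1_card; apply: eq_bigl => y; rewrite inE.
Qed.

(* The blocks of the [i]-th array are (x, x + c_k, x + s_k) with s = s_i, x in Z_m.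
   [e = shifted_diffs n K c s] is s - c + K modulo n.  Either n = w = m, and the
   row works in Z_m only, or n = 0: then e is the integer s + K - c, and the row
   works in Z_m for every m >= w. *)
Definition shifted_diffs (n K : nat) (c s : seq nat) : seq nat :=
  [seq (x.2 + K - x.1) %% n | x <- zip c s].

(** Distinct entries of [c], [s] and [e] give determinacy for the three pairs of coordinates, the
    permutation conditions give balance, the pairwise one disjointness. The inequality keeps the
    subtraction in [shifted_diffs] from truncating. *)
Definition base_row (n w K : nat) (c s0 s1 s2 : seq nat) : bool :=
  let e := shifted_diffs n K c in let ss := [:: s0; s1; s2] in
  [&& uniq c, all (gtn w) c,
      all (fun s => [&& size s == size c, uniq s, all (gtn w) s & perm_eq s s0]) ss,
      all (fun s => [&& uniq (e s), all (gtn w) (e s) & perm_eq (e s) (e s0)]) ss,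
      all (fun s => all (fun x => x.1 <= x.2 + K) (zip c s)) ss &
      pairwise (fun s s' => all (fun x => x.1 != x.2) (zip s s')) ss].

Lemma ord3_other (p q : 'I_3) : p != q -> exists r : 'I_3, r != p /\ r != q.
Proof.
move=> pq; have r3 : 3 - p - q < 3 by move: pq; rewrite -val_eqE /=; lia.
by exists (Ordinal r3); move: pq (ltn_ord p) (ltn_ord q); rewrite -!val_eqE /=; lia.
Qed.

Lemma ord3_cover (p q r s : 'I_3) :
  p != q -> r != p -> r != q -> s != r -> s = p \/ s = q.
Proof.
move=> pq rp rq sr.
suff : (val s == val p) || (val s == val q) by move=> /orP[]/eqP/val_inj; auto.
by move: pq rp rq sr (ltn_ord p) (ltn_ord q) (ltn_ord r) (ltn_ord s); rewrite -!val_eqE /=; lia.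
Qed.

Lemma ord3_neq (p : 'I_3) : exists q : 'I_3, q != p.
Proof.
exists (if p == ord0 then ord_max else ord0).
by case: ifP => [/eqP->|] //; rewrite eq_sym => ->.
Qed.

(** * Constructions over finite abelian groups *)

Section Constructions.
Local Open Scope ring_scope.

Lemma subr_addl2 (G : zmodType) (x y z : G) : (x + y) - (x + z) = y - z.
Proof. by rewrite opprD addrACA subrr add0r. Qed.

Lemma Zp_natr_inj n (a b : nat) :
  (a < n.+2)%N -> (b < n.+2)%N -> a%:R = b%:R :> 'I_n.+2 -> a = b.
Proof. by move=> an bn /(congr1 val); rewrite !Zp_nat /= !modn_small. Qed.

Lemma Zp_natr_eqmod n (a b k : nat) :
  (n.+2 %| k)%N -> (a = b %[mod k])%N -> a%:R = b%:R :> 'I_n.+2.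
Proof.
by move=> nk E; apply/val_inj; rewrite !Zp_nat /= -(modn_dvdm a nk) E modn_dvdm.
Qed.

(** The blocks of [T i] are the triples over Z_m with sum i; the three Latin squares are disjoint
    because 0, 1, 2 are distinct modulo [m]. *)
Lemma latin_square_trade m : (2 < m)%N -> has_latin_trade m m.
Proof.
case: m => [|[|[|n]]] // _; set G := 'I_n.+3.
pose T (i : 'I_3) := [set f : {ffun 'I_3 -> G} | \sum_s f s == (val i)%:R].
have adjust (f : {ffun 'I_3 -> G}) r (c : G) :
    exists g : {ffun 'I_3 -> G}, \sum_s g s = c /\ forall s, s != r -> g s = f s.
  exists [ffun s => f s + (if s == r then c - \sum_s f s else 0)]; split.
    under eq_bigr do rewrite ffunE.
    by rewrite big_split -big_mkcond big_pred1_eq /= addrCA subrr addr0.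
  by move=> s /negPf sr; rewrite ffunE sr addr0.
have det i p q f g : p != q -> f \in T i -> g \in T i ->
    f p = g p -> f q = g q -> f = g.
  move=> pq; rewrite !inE => /eqP fi /eqP gi Ep Eq.
  have [r [rp rq]] := ord3_other pq.
  have E s : s != r -> f s = g s.
    by move=> sr; have [->|->] := ord3_cover pq rp rq sr.
  apply/ffunP => s; have [->|/E //] := eqVneq s r.
  have : \sum_s f s = \sum_s g s by rewrite fi gi.
  by rewrite (bigD1 r) // [RHS](bigD1 r) //= (eq_bigr _ E) => /addIr.
have -> : n.+3 = #|G| by rewrite card_ord.
apply: (@has_latin_trade_card _ _ T); split=> //.
- move=> i j p q f pq _; have [r [rp rq]] := ord3_other pq.
  have [g [gj E]] := adjust f r (val j)%:R.
  by exists g; rewrite inE gj eqxx !E // eq_sym.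
- move=> i j f; rewrite !inE => /eqP -> /eqP/Zp_natr_inj E.
  by apply/val_inj/E; apply: leq_trans (ltn_ord _) _.
- move=> i p a; have [q qp] := ord3_neq p.
  (* Blocks with [f p = a] are counted by their value at another coordinate [q], which takes every
     value in [G]. *)
  rewrite -(card_in_imset (f := fun f : {ffun 'I_3 -> G} => f q)); last first.
    move=> f g /setIdP[fT /eqP fp] /setIdP[gT /eqP gp] Eq.
    by apply: (det i p q); rewrite // 1?eq_sym // fp.
  rewrite -cardsT; apply: eq_card => x; rewrite inE; apply/imsetP.
  have pq : p != q by rewrite eq_sym.
  have [r [rp rq]] := ord3_other pq.
  have [g [gi E]] := adjust [ffun s => if s == p then a else x] r (val i)%:R.
  exists g; first by rewrite !inE gi eqxx E 1?eq_sym // ffunE eqxx /=.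
  by rewrite E 1?eq_sym // ffunE (negPf qp).
Qed.

(** Coordinate differences determine a block up to translation by [G], so the three hypotheses are
    determinacy, balance and disjointness modulo translation. *)
Lemma developed_trade (G : finZmodType) (K : finType) (b : 'I_3 -> K -> 'I_3 -> G) :
  (forall i p q, p != q -> injective (fun k => b i k p - b i k q)) ->
  (forall i j p q k, p != q ->
    exists k', b i k p - b i k q = b j k' p - b j k' q) ->
  (forall i j k k', (forall p q, b i k p - b i k q = b j k' p - b j k' q) -> i = j) ->
  has_latin_trade #|K| #|G|.
Proof.
move=> inj bal dis.
pose t i (u : K * G) : {ffun 'I_3 -> G} := [ffun p => u.2 + b i u.1 p].
have diff i j u v p q : t i u p = t j v p -> t i u q = t j v q ->
    b i u.1 p - b i u.1 q = b j v.1 p - b j v.1 q.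
  by rewrite !ffunE => Ep Eq; rewrite -(subr_addl2 u.2) Ep Eq subr_addl2.
have det i p q u v : p != q -> t i u p = t i v p -> t i u q = t i v q -> u = v.
  move=> pq Ep Eq; have /inj E := diff _ _ _ _ _ _ Ep Eq.
  case: u v E Ep {Eq} => k x [l y] /= E; rewrite !ffunE /=.
  by rewrite (E pq) => /addIr ->.
apply: (@has_latin_trade_card _ _ (fun i => [set t i u | u in [set: K * G]])); split.
- move=> i p q f g pq /imsetP[u _ ->] /imsetP[v _ ->] Ep Eq.
  by rewrite (det i p q u v).
- move=> i j p q f pq /imsetP[[k x] _ ->].
  have [l E] := bal i j p q k pq.
  (* The translate is chosen to agree at [p]; equal differences then make it agree at [q]. *)
  exists (t j (l, x + b i k p - b j l p)); rewrite imset_f // !ffunE /= subrK; split=> //.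
  by rewrite -addrA [- _ + _]addrC -opprB -E opprB -addrA [b i k p + _]addrC subrK.
- move=> i j f /imsetP[[k x] _ ->] /imsetP[[l y] _ /ffunP E].
  by apply: (dis i j k l) => p q; apply: diff (k, x) (l, y) p q (E p) (E q).
- move=> i p a; pose h k := t i (k, a - b i k p).
  have hI : injective h.
    move=> k l /ffunP E; have [q qp] := ord3_neq p.
    by have [] := det i q p _ _ qp (E q) (E p).
  rewrite -cardsT -(card_imset _ hI); apply: eq_card => f; rewrite inE.
  apply/andP/imsetP.
    move=> [/imsetP[[k x] _ ->]]; rewrite ffunE /= => /eqP Ea.
    by exists k; rewrite // /h -Ea addrK.
  by move=> [k _ ->]; rewrite /h imset_f // ffunE /= subrK.
Qed.

(** The base blocks (0, c_k, s_k) have, up to sign, the differences c_k, s_k and c_k - s_k = K -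
    e_k. The hypothesis [m %| n] covers both [n = m] and [n = 0]. *)
Lemma base_row_trade n w K c s0 s1 s2 m :
  (1 < m)%N -> base_row n w K c s0 s1 s2 -> (w <= m)%N -> (m %| n)%N ->
  has_latin_trade (size c) m.
Proof.
case: m => [|[|m]] // _ /and5P[cU cw /allP ssP /allP eP /andP[/allP leP neP]] wm mn.
pose ss := [:: s0; s1; s2].
pose s (i : 'I_3) := nth [::] ss i.
have sI i : s i \in ss by rewrite mem_nth.
pose e i := shifted_diffs n K c (s i).
have size_s i : size (s i) = size c by have /and4P[/eqP] := ssP _ (sI i).
have size_e i : size (e i) = size c by rewrite size_map size_zip size_s minnn.
have kc (k : 'I_(size c)) : (k < size c)%N by [].
pose ck (k : 'I_(size c)) : nat := nth 0%N c k.
pose sk i (k : 'I_(size c)) : nat := nth 0%N (s i) k.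
pose ek i (k : 'I_(size c)) : nat := nth 0%N (e i) k.
have eE i k : (ek i k + ck k = sk i k + K %[mod n])%N.
  rewrite /ek (nth_map (0, 0)%N) ?size_zip ?size_s ?minnn // nth_zip ?size_s //=.
  rewrite modnDml subnK //.
  have /allP/(_ (ck k, sk i k)) := leP _ (sI i); apply.
  by rewrite -nth_zip ?size_s // mem_nth // size_zip size_s minnn.
have eR i k : (ck k)%:R - (sk i k)%:R = K%:R - (ek i k)%:R :> 'I_m.+2.
  have := Zp_natr_eqmod mn (eE i k); rewrite !natrD => E.
  by apply/eqP; rewrite subr_eq addrAC eq_sym subr_eq addrC [X in _ == X]addrC E addrC.
have natI (a b : nat) : (a < w)%N -> (b < w)%N -> a%:R = b%:R :> 'I_m.+2 -> a = b.
  by move=> aw bw; apply: Zp_natr_inj; apply: leq_trans wm.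
have ckI : injective (fun k => (ck k)%:R : 'I_m.+2).
  move=> k l /natI E; apply/val_inj/(uniqP 0%N cU); rewrite ?inE ?kc //; apply: E;
  by apply: (allP cw); rewrite mem_nth.
have skI i : injective (fun k => (sk i k)%:R : 'I_m.+2).
  have /and4P[_ sU sw _] := ssP _ (sI i).
  move=> k l /natI E; apply/val_inj/(uniqP 0%N sU); rewrite ?inE ?size_s ?kc //; apply: E;
  by apply: (allP sw); rewrite mem_nth ?size_s.
have ekI i : injective (fun k => (ek i k)%:R : 'I_m.+2).
  have /and3P[eU ew _] := eP _ (sI i).
  move=> k l /natI E; apply/val_inj/(uniqP 0%N eU); rewrite ?inE ?size_e ?kc //; apply: E;
  by apply: (allP ew); rewrite mem_nth ?size_e.
have find (x t : seq nat) (k : 'I_(size c)) :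
    size x = size c -> size t = size c -> x =i t ->
    exists l : 'I_(size c), nth 0%N x k = nth 0%N t l.
  move=> sx st xt; have : nth 0%N x k \in t by rewrite -xt mem_nth ?sx.
  by move=> /(nthP 0%N)[l]; rewrite st => lc El; exists (Ordinal lc).
have sfind i j k : exists l, sk i k = sk j l.
  apply: find => //; apply: perm_mem.
  have /and4P[_ _ _ Pi] := ssP _ (sI i); have /and4P[_ _ _ Pj] := ssP _ (sI j).
  by rewrite (perm_trans Pi) // perm_sym.
have efind i j k : exists l, ek i k = ek j l.
  apply: find => //; apply: perm_mem.
  have /and3P[_ _ Pi] := eP _ (sI i); have /and3P[_ _ Pj] := eP _ (sI j).
  by rewrite (perm_trans Pi) // perm_sym.
pose b i k (p : 'I_3) : 'I_m.+2 := nth 0 [:: 0; (ck k)%:R; (sk i k)%:R] p.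
rewrite -(card_ord (size c)) -(card_ord m.+2).
apply: (developed_trade (b := b)).
- move=> i p q; apply: (ord3_sym_ind (P := fun p q => injective (fun k => b i k p - b i k q))).
  + move=> {}p {}q I k l E; apply: I; move/(congr1 -%R): E.
    by rewrite !opprB.
  + by move=> k l; rewrite /b !inordK //= !sub0r => /oppr_inj/ckI.
  + by move=> k l; rewrite /b !inordK //= !sub0r => /oppr_inj/skI.
  + by move=> k l; rewrite /b !inordK //= !eR => /addrI/oppr_inj/ekI.
- move=> i j p q k.
  apply: (ord3_sym_ind (P := fun p q => exists l, b i k p - b i k q = b j l p - b j l q)).
  + by move=> {}p {}q [l E]; exists l; rewrite -opprB E opprB.
  + by exists k; rewrite /b !inordK.
  + by have [l E] := sfind i j k; exists l; rewrite /b !inordK //= E.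
  + by have [l E] := efind i j k; exists l; rewrite /b !inordK //= !eR E.
(* Coordinates 1 and 0 give [k = l]; coordinates 2 and 0 then make [s i] and [s j] agree at [k],
   which the pairwise condition forbids when [i] and [j] differ. *)
move=> i j k l E.
have := E (inord 1) (inord 0); rewrite /b !inordK //= !subr0 => /ckI kl.
have := E (inord 2) (inord 0); rewrite /b !inordK //= !subr0 -kl => /natI {}E.
have {}E : sk i k = sk j k.
  have /and4P[_ _ wi _] := ssP _ (sI i); have /and4P[_ _ wj _] := ssP _ (sI j).
  by apply: E; [apply: (allP wi) | apply: (allP wj)]; rewrite mem_nth ?size_s.
have ne (i' j' : 'I_3) : (i' < j')%N -> sk i' k != sk j' k.
  move=> ij; have /(pairwiseP [::])/(_ i' j' (ltn_ord i') (ltn_ord j') ij)/allP := neP.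
  move/(_ (sk i' k, sk j' k)); apply.
  by rewrite -nth_zip ?size_s // mem_nth // size_zip !size_s minnn.
by apply/val_inj; case: (ltngtP i j) => // /ne; rewrite E eqxx.
Qed.

(* The cells are (a, u) in G x G, a being the entry of the mate, with coordinates u + th p a. *)
Lemma product_trade (G : finZmodType) (th : 'I_3 -> G -> G) (dl : G -> nat) M :
  (forall p q, p != q -> injective (fun a => th p a - th q a)) ->
  (forall a, has_latin_trade (dl a) M) ->
  has_latin_trade (\sum_a dl a)%N (#|G| * M)%N.
Proof.
move=> thI /fin_all_exists[T LT].
pose mk (t : G * G * {ffun 'I_3 -> 'I_M}) : {ffun 'I_3 -> G * 'I_M} :=
  [ffun p => (t.1.2 + th p t.1.1, t.2 p)].
pose D i := [set t : G * G * {ffun 'I_3 -> 'I_M} | t.2 \in T t.1.1 i].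
(* The difference of the first components at [p] and [q] recovers the mate entry by [thI]; one of
   them then recovers the other cell parameter. *)
have mk_eq t u p q : p != q -> mk t p = mk u p -> mk t q = mk u q ->
    [/\ t.1 = u.1, t.2 p = u.2 p & t.2 q = u.2 q].
  move=> pq; case: t u => -[a x] f [[b y] g]; rewrite !ffunE /=.
  move=> [Ep Fp] [Eq Fq]; split=> //.
  have ab : a = b by apply: (thI p q pq); rewrite -(subr_addl2 x) Ep Eq subr_addl2.
  by move: Ep; rewrite ab => /addIr ->.
have mkI : injective mk.
  move=> t u /ffunP E; have [E1 _ _] := mk_eq t u ord0 ord_max isT (E _) (E _).
  case: t u E E1 => t f [u g] /= E ->; congr pair; apply/ffunP => p.
  by have := E p; rewrite !ffunE /= => -[].
have -> : (#|G| * M)%N = #|{: G * 'I_M}| by rewrite card_prod card_ord.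
apply: (@has_latin_trade_card _ _ (fun i => mk @: D i)); split.
- move=> i p q f g pq /imsetP[t tD ->] /imsetP[u uD ->] Ep Eq.
  have [E Fp Fq] := mk_eq t u p q pq Ep Eq; congr mk.
  case: t u E Fp Fq tD uD {Ep Eq} => [[a x] f'] [[b y] g'] /= [-> ->] Fp Fq.
  by rewrite !inE /= => fT gT; rewrite (latin_determined (LT b) pq fT gT Fp Fq).
- move=> i j p q f pq /imsetP[[[a x] f']]; rewrite inE /= => fT ->.
  have [g [gT Ep Eq]] := latin_balanced (LT a) j pq fT.
  by exists (mk (a, x, g)); rewrite imset_f ?inE // !ffunE /= Ep Eq.
- move=> i j f /imsetP[[[a x] f']]; rewrite inE /= => fT -> /imsetP[u + /mkI E].
  by rewrite -E inE /= => /(latin_disjoint (LT a) fT).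
move=> i p [x k].
(* Given the mate entry [a], a block through (x, k) must sit in the cell with parameter
   [x - th p a]. *)
pose h (t : G * {ffun 'I_3 -> 'I_M}) := mk (t.1, x - th p t.1, t.2).
have hI : injective h by move=> [a f] [b g] /mkI[-> _ ->].
under eq_bigr => a _ do rewrite -(latin_degree (LT a) i p k).
rewrite -(card_dep_pairs (fun a f => (f \in T a i) && (f p == k))) -(card_imset _ hI).
apply: eq_card => f; rewrite inE; apply/andP/imsetP.
  move=> [/imsetP[[[a y] f']]]; rewrite inE /= => fT ->; rewrite ffunE /= => /eqP[Ex Ek].
  by exists (a, f'); [rewrite inE /= fT Ek /= | rewrite /h /= -Ex addrK].
move=> [[a f']]; rewrite inE /= => /andP[fT /eqP Ek] ->.
by rewrite /h imset_f ?inE // ffunE /= subrK Ek.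
Qed.

Lemma sumn_labels (G : finType) (dl : seq nat) :
  size dl = #|G| -> exists l : G -> nat, (\sum_a l a)%N = sumn dl /\ forall a, l a \in dl.
Proof.
move=> sG; exists (fun a => nth 0%N dl (enum_rank a)); split; last first.
  by move=> a; rewrite mem_nth // sG.
rewrite sumnE (big_nth 0%N) sG big_mkord [RHS](reindex (@enum_rank G)) //=.
by exists enum_val => a _; rewrite ?enum_valK ?enum_rankK.
Qed.

(* The columns u + p a, p = 0, 1, 2, are pairwise orthogonal as 1 and 2 are units modulo n. *)
Lemma odd_product_trade n M (dl : seq nat) :
  odd n -> size dl = n -> {in dl, forall d, has_latin_trade d M} ->
  has_latin_trade (sumn dl) (n * M)%N.
Proof.
case: n => [|[|n]] // n_odd sdl dlM.
  (* For [n = 1] the product is the single trade in its only cell. *)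
  by case: dl sdl dlM => [|d []] // _ /(_ d); rewrite inE eqxx mul1n /= addn0; apply.
have [|l [<- ldl]] := @sumn_labels 'I_n.+2 dl; first by rewrite card_ord.
rewrite -[X in (X * M)%N]card_ord.
apply: (@product_trade 'I_n.+2 (fun p a => a *+ p)) => [p q|a]; last exact/dlM/ldl.
apply: (ord3_sym_ind (P := fun p q => injective (fun a => a *+ p - a *+ q))).
- move=> {}p {}q I a b E; apply: I; move/(congr1 -%R): E.
  by rewrite !opprB.
- by move=> a b; rewrite !inordK //= !sub0r => /oppr_inj.
- move=> a b; rewrite !inordK //= !sub0r => /oppr_inj E.
  (* Half of n + 3 inverts 2 modulo the odd number n + 2. *)
  have h2 (x : 'I_n.+2) : x *+ 2 *+ (n.+3)./2 = x.
    have En : (2 * (n.+3)./2 = n.+3)%N by move: n_odd; rewrite /=; lia.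
    have /eqP : n.+2%:R = 0 :> 'I_n.+2 by apply/val_inj; rewrite Zp_nat /= modnn.
    rewrite -mulrnA En mulrSr => E0; rewrite -[x *+ _]mulr_natr (eqP E0) mulr0 add0r //.
  by rewrite -(h2 a) E h2.
- move=> a b; rewrite !inordK //= => /(congr1 -%R).
  by rewrite !opprB !mulr2n !mulr1n !addrK.
Qed.

(** Doubling is not injective on Z_4, so the multipliers are three distinct elements of F_4, whose
    differences are invertible. *)
Lemma four_product_trade M (dl : seq nat) :
  size dl = 4 -> {in dl, forall d, has_latin_trade d M} ->
  has_latin_trade (sumn dl) (4 * M)%N.
Proof.
move=> sdl dlM; have [F _ cF] := @pPrimePowerField 2 2 isT isT.
have [|l [<- ldl]] := @sumn_labels F dl; first by rewrite cF.
have F3 : (3 <= #|F|)%N by rewrite cF.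
pose c p : F := enum_val (widen_ord F3 p).
rewrite -[4%N]cF.
apply: (@product_trade F (fun p a => c p * a)) => [p q pq|a]; last exact/dlM/ldl.
have cpq : c p - c q != 0.
  by rewrite subr_eq0; apply: contraNneq pq => /enum_val_inj/(congr1 val)/= /val_inj ->.
by move=> a b; rewrite -!mulrBl; apply: mulfI.
Qed.

End Constructions.

(** * Base rows for degrees 4 to 13 and 15 *)

(* The base rows below were found by computer search. *)
Lemma latin_trade_4_5 : has_latin_trade 4 5.
Proof.
exact: (@base_row_trade 5 5 5 [:: 0; 1; 2; 3]
  [:: 4; 2; 0; 3] [:: 3; 0; 2; 4] [:: 0; 4; 3; 2]).
Qed.

Lemma latin_trade_5_7 : has_latin_trade 5 7.
Proof.
exact: (@base_row_trade 7 7 7 [:: 0; 1; 2; 3; 4]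
  [:: 4; 0; 3; 1; 6] [:: 1; 6; 4; 0; 3] [:: 6; 3; 0; 4; 1]).
Qed.

Lemma latin_trade_5_8 : has_latin_trade 5 8.
Proof.
exact: (@base_row_trade 8 8 8 [:: 0; 1; 4; 5; 6]
  [:: 0; 6; 3; 1; 4] [:: 4; 0; 1; 3; 6] [:: 6; 1; 0; 4; 3]).
Qed.

Lemma latin_trade_5_9 : has_latin_trade 5 9.
Proof.
exact: (@base_row_trade 9 9 9 [:: 0; 1; 3; 5; 6]
  [:: 4; 0; 1; 2; 7] [:: 7; 2; 0; 4; 1] [:: 1; 7; 2; 0; 4]).
Qed.

Lemma latin_trade_5_11 : has_latin_trade 5 11.
Proof.
exact: (@base_row_trade 11 11 11 [:: 0; 4; 7; 9; 10]
  [:: 1; 3; 10; 0; 6] [:: 10; 6; 3; 1; 0] [:: 3; 0; 6; 10; 1]).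
Qed.

Lemma latin_trade_6_7 : has_latin_trade 6 7.
Proof.
exact: (@base_row_trade 7 7 7 [:: 1; 2; 3; 4; 5; 6]
  [:: 1; 6; 4; 2; 0; 5] [:: 5; 0; 2; 4; 6; 1] [:: 2; 1; 0; 6; 5; 4]).
Qed.

(** With [n = 0] differences are compared as integers, so one row of width 8 serves every order from
    8 on. *)
Lemma latin_trade_6 m : 7 < m -> has_latin_trade 6 m.
Proof.
move=> wm; apply: (@base_row_trade 0 8 2
  [:: 0; 2; 3; 4; 5; 7]
  [:: 1; 5; 2; 6; 3; 7]
  [:: 2; 1; 3; 7; 6; 5]
  [:: 3; 2; 1; 5; 7; 6]) => //.
exact: leq_trans wm.
Qed.

(** Here and for the larger degrees the width is the degree plus 1, which leaves only order [d] to
    the Latin square. *)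
Lemma latin_trade_7 m : 7 < m -> has_latin_trade 7 m.
Proof.
move=> wm; apply: (@base_row_trade 0 8 3
  [:: 0; 1; 2; 3; 4; 6; 7]
  [:: 1; 4; 2; 7; 6; 3; 5]
  [:: 3; 1; 6; 5; 2; 7; 4]
  [:: 2; 5; 3; 6; 1; 4; 7]) => //.
exact: leq_trans wm.
Qed.

Lemma latin_trade_8 m : 8 < m -> has_latin_trade 8 m.
Proof.
move=> wm; apply: (@base_row_trade 0 9 3
  [:: 0; 1; 2; 3; 4; 5; 6; 8]
  [:: 5; 2; 0; 7; 6; 4; 3; 8]
  [:: 4; 0; 7; 3; 2; 6; 8; 5]
  [:: 0; 3; 6; 8; 5; 2; 4; 7]) => //.
exact: leq_trans wm.
Qed.

Lemma latin_trade_9 m : 9 < m -> has_latin_trade 9 m.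
Proof.
move=> wm; apply: (@base_row_trade 0 10 4
  [:: 0; 1; 2; 3; 4; 5; 6; 8; 9]
  [:: 2; 6; 1; 0; 7; 9; 4; 8; 5]
  [:: 0; 5; 4; 8; 2; 1; 9; 7; 6]
  [:: 4; 1; 0; 6; 9; 7; 2; 5; 8]) => //.
exact: leq_trans wm.
Qed.

Lemma latin_trade_10 m : 10 < m -> has_latin_trade 10 m.
Proof.
move=> wm; apply: (@base_row_trade 0 11 5
  [:: 0; 1; 2; 3; 5; 6; 7; 8; 9; 10]
  [:: 0; 6; 3; 1; 9; 2; 4; 10; 8; 5]
  [:: 5; 1; 6; 2; 0; 3; 9; 4; 10; 8]
  [:: 2; 5; 1; 0; 10; 4; 8; 3; 9; 6]) => //.
exact: leq_trans wm.
Qed.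

Lemma latin_trade_11 m : 11 < m -> has_latin_trade 11 m.
Proof.
move=> wm; apply: (@base_row_trade 0 12 5
  [:: 0; 1; 2; 3; 4; 5; 7; 8; 9; 10; 11]
  [:: 3; 5; 4; 8; 1; 11; 2; 6; 10; 9; 7]
  [:: 1; 4; 6; 9; 2; 10; 3; 7; 11; 5; 8]
  [:: 2; 6; 5; 7; 10; 1; 4; 3; 8; 11; 9]) => //.
exact: leq_trans wm.
Qed.

Lemma latin_trade_12 m : 12 < m -> has_latin_trade 12 m.
Proof.
move=> wm; apply: (@base_row_trade 0 13 6
  [:: 0; 2; 3; 4; 5; 6; 7; 8; 9; 10; 11; 12]
  [:: 2; 6; 4; 10; 3; 11; 1; 8; 12; 5; 7; 9]
  [:: 5; 8; 7; 6; 2; 1; 3; 11; 10; 4; 9; 12]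
  [:: 3; 7; 1; 8; 11; 2; 9; 5; 4; 10; 12; 6]) => //.
exact: leq_trans wm.
Qed.

Lemma latin_trade_13 m : 13 < m -> has_latin_trade 13 m.
Proof.
move=> wm; apply: (@base_row_trade 0 14 6
  [:: 0; 1; 2; 3; 4; 5; 6; 7; 9; 10; 11; 12; 13]
  [:: 6; 1; 7; 2; 11; 8; 0; 4; 13; 5; 12; 10; 9]
  [:: 5; 4; 0; 9; 1; 12; 10; 2; 8; 11; 7; 6; 13]
  [:: 1; 6; 8; 10; 0; 2; 4; 11; 9; 13; 5; 7; 12]) => //.
exact: leq_trans wm.
Qed.

Lemma latin_trade_15 m : 15 < m -> has_latin_trade 15 m.
Proof.
move=> wm; apply: (@base_row_trade 0 16 8
  [:: 0; 1; 2; 3; 4; 5; 6; 7; 9; 10; 11; 12; 13; 14; 15]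
  [:: 5; 1; 6; 4; 3; 12; 8; 0; 15; 2; 14; 7; 9; 11; 13]
  [:: 2; 5; 1; 3; 11; 0; 9; 13; 7; 15; 4; 8; 14; 6; 12]
  [:: 4; 6; 9; 5; 0; 11; 3; 2; 1; 8; 12; 15; 13; 7; 14]) => //.
exact: leq_trans wm.
Qed.

(** * Small degrees in all orders *)

Lemma latin_trade_degree4 m :
  4 <= m -> m != 6 -> m != 7 -> m != 11 -> has_latin_trade 4 m.
Proof.
have t4 : has_latin_trade 4 4 by exact: latin_square_trade.
have t5 := latin_trade_4_5.
have t8 : has_latin_trade 4 8 := has_latin_trade_sum t4 t4.
have t9 : has_latin_trade 4 9 := has_latin_trade_sum t4 t5.
have t10 : has_latin_trade 4 10 := has_latin_trade_sum t5 t5.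
elim/ltn_ind: m => m IH m4 m6 m7 m11.
have [->//|n4] := eqVneq m 4; have [->//|n5] := eqVneq m 5.
have [->//|n8] := eqVneq m 8; have [->//|n9] := eqVneq m 9.
(* Removing 4 from 10 or 15 would leave the excluded order 6 or 11. *)
have [->//|n10] := eqVneq m 10; have [->|n15] := eqVneq m 15.
  exact: has_latin_trade_sum t5 t10.
have -> : m = m - 4 + 4 by lia.
by apply: has_latin_trade_sum => //; apply: IH; lia.
Qed.

(** Induction removes a Latin square of order 5. This fails for 7, 8, 9, which drop below 5, and for
    11, which drops to 6; these have their own rows. *)
Lemma latin_trade_degree5 m : 5 <= m -> m != 6 -> has_latin_trade 5 m.
Proof.
have t5 : has_latin_trade 5 5 by exact: latin_square_trade.
elim/ltn_ind: m => m IH m5 m6.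
have [->//|n5] := eqVneq m 5; have [->|n7] := eqVneq m 7; first exact: latin_trade_5_7.
have [->|n8] := eqVneq m 8; first exact: latin_trade_5_8.
have [->|n9] := eqVneq m 9; first exact: latin_trade_5_9.
have [->|n11] := eqVneq m 11; first exact: latin_trade_5_11.
have -> : m = m - 5 + 5 by lia.
by apply: has_latin_trade_sum => //; apply: IH; lia.
Qed.

Lemma latin_trade_small d m :
  (6 <= d <= 13) || (d == 15) -> d <= m -> has_latin_trade d m.
Proof.
move=> dE dm; have [->|md] := eqVneq m d; first by apply: latin_square_trade; lia.
have {}dm : d < m by lia.
have [d6|d6] := eqVneq d 6.
  subst d; have [->|m7] := eqVneq m 7; first exact: latin_trade_6_7.
  by apply: latin_trade_6; lia.
have /or4P[/eqP Ed|/eqP Ed|/eqP Ed|/or4P[/eqP Ed|/eqP Ed|/eqP Ed|/orP[]/eqP Ed]] :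
    [|| d == 7, d == 8, d == 9 | [|| d == 10, d == 11, d == 12 | (d == 13) || (d == 15)]].
  by lia.
all: subst d.
- exact: latin_trade_7.
- exact: latin_trade_8.
- exact: latin_trade_9.
- exact: latin_trade_10.
- exact: latin_trade_11.
- exact: latin_trade_12.
- exact: latin_trade_13.
- exact: latin_trade_15.
Qed.

(** * Splitting a degree among the cells of a product *)

Lemma degree_split lo M q g d :
  q <= g -> q * lo <= d <= q * M ->
  exists dl : seq nat, [/\ size dl = g, sumn dl = d
    & {in dl, forall x, x = 0 \/ lo <= x <= M}].
Proof.
elim: g q d => [|g IH] q d qg dq.
  have q0 : q = 0 by lia.
  by exists [::]; split=> //=; subst q; lia.
case: q qg dq => [|q] qg dq.
  have [dl [sdl sd dlP]] := IH 0 d (leq0n g) dq.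
  exists (0 :: dl); split; rewrite /= ?sdl // => x; rewrite inE => /orP[/eqP ->|/dlP //]; by left.
(* The least label after which [q] labels of size at most [M] can still supply the rest. *)
pose x := maxn lo (d - q * M).
have [||dl [sdl sd dlP]] := IH q (d - x); [by [] | by rewrite /x; nia |].
exists (x :: dl); split; rewrite /= ?sdl ?sd //; first by rewrite /x; nia.
by move=> y; rewrite inE => /orP[/eqP ->|/dlP //]; right; rewrite /x; nia.
Qed.

Lemma degree_split_large lo M g d :
  (lo == 4) && (5 <= M) || (lo == 5) && (7 <= M) -> 14 <= d <= g * M ->
  exists dl : seq nat, [/\ size dl = g, sumn dl = d
    & {in dl, forall x, x = 0 \/ lo <= x <= M}].
Proof.
move=> loM dE; have M0 : 0 < M by lia.
(* [d / M] rounded up: the fewest labels that can reach [d]. *)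
pose q := (d + M.-1) %/ M.
have qE := divn_eq (d + M.-1) M; have := ltn_pmod (d + M.-1) M0; rewrite -/q in qE => r.
apply: (@degree_split lo M q) => //.
  by rewrite -ltnS /q ltn_divLR //; lia.
(* For [q >= 4], [q * lo <= d] follows from d > (q - 1) M. For smaller [q] the bound [14 <= d]
   suffices, except that [lo = 5], [q = 3] uses d > 2 M >= 14. *)
have [q3|q3] := leqP q 3; last by apply/andP; split; nia.
by apply/andP; split; nia.
Qed.

Lemma latin_trade_extend lo M g d :
  (forall dl : seq nat, size dl = g -> {in dl, forall d, has_latin_trade d M} ->
     has_latin_trade (sumn dl) (g * M)) ->
  (lo == 4) && (5 <= M) || (lo == 5) && (7 <= M) ->
  (forall d, lo <= d <= M -> has_latin_trade d M) ->
  14 <= d <= g * M -> has_latin_trade d (g * M).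
Proof.
move=> prod loM full dE; have [dl [sdl <- dlP]] := degree_split_large loM dE.
by apply: prod => // x /dlP[->|/full //]; apply: has_latin_trade0.
Qed.

(** * Multiples of 5 and 7, and large orders *)

(** Latin squares of order 2 have no orthogonal mate, so products multiply by odd numbers or by 4,
    and a leftover factor 2 goes into the base. *)
Lemma odd_four_ind (P : nat -> Prop) :
  P 1 -> P 2 -> (forall n, 0 < n -> P n -> P (4 * n)) ->
  (forall o n, odd o -> 0 < n -> P n -> P (o * n)) -> forall n, 0 < n -> P n.
Proof.
move=> P1 P2 P4 Po n; elim/ltn_ind: n => n IH n0.
have [on|en] := boolP (odd n); first by rewrite -[n]muln1; apply: Po.
have nE : n = n./2 * 2 by lia.
have [on2|en2] := boolP (odd n./2); first by rewrite nE; apply: Po.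
have -> : n = 4 * (n./2)./2 by lia.
by apply: P4; [|apply: IH]; lia.
Qed.

Lemma latin_trade_degree_lt14 d m : 4 <= d < 14 -> d <= m ->
  (d = 4 -> [/\ m != 6, m != 7 & m != 11]) -> (d = 5 -> m != 6) -> has_latin_trade d m.
Proof.
move=> dE dm m4 m5.
have [d4|n4] := eqVneq d 4; first by subst d; have [] := m4 erefl; exact: latin_trade_degree4.
have [d5|n5] := eqVneq d 5; first by subst d; apply: latin_trade_degree5; rewrite ?m5.
by apply: latin_trade_small; lia.
Qed.

(** The base orders 5 and 10 involve only degrees below 14, and no multiple of 5 is among the
    exceptional orders 6, 7, 11. *)
Lemma latin_trade_mul5 n d : 4 <= d <= n * 5 -> has_latin_trade d (n * 5).
Proof.
move=> dn; have n0 : 0 < n by lia.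
pose P n := forall d, 4 <= d <= n * 5 -> has_latin_trade d (n * 5).
suff /(_ n n0) : forall n, 0 < n -> P n by exact.
have small k c : 4 <= c < 14 -> c <= k * 5 -> has_latin_trade c (k * 5).
  by move=> cE ck; apply: latin_trade_degree_lt14 => // _; [split|]; lia.
have step o k : (forall dl : seq nat, size dl = o ->
      {in dl, forall d, has_latin_trade d (k * 5)} ->
      has_latin_trade (sumn dl) (o * (k * 5))) -> 0 < k -> P k -> P (o * k).
  move=> prod k0 Pk c cE; have [c14|c14] := ltnP c 14; first by apply: small; lia.
  (* Degrees from 14 on split into zeros and labels from 4 to [k * 5], available by [Pk]. *)
  by rewrite -mulnA; apply: (@latin_trade_extend 4) => //; lia.
apply: odd_four_ind.
- by move=> c cE; apply: small; lia.
- by move=> c cE; apply: small; lia.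
- by move=> k; apply: step => dl; apply: four_product_trade.
- by move=> o k oo; apply: step => dl; apply: odd_product_trade.
Qed.

(** Degrees start at 5 because degree 4 is not constructed in order 7. *)
Lemma latin_trade_mul7 n d : 5 <= d <= n * 7 -> has_latin_trade d (n * 7).
Proof.
move=> dn; have n0 : 0 < n by lia.
pose P n := forall d, 5 <= d <= n * 7 -> has_latin_trade d (n * 7).
suff /(_ n n0) : forall n, 0 < n -> P n by exact.
have small k c : 5 <= c < 14 -> c <= k * 7 -> has_latin_trade c (k * 7).
  by move=> cE ck; apply: latin_trade_degree_lt14; lia.
have step o k : (forall dl : seq nat, size dl = o ->
      {in dl, forall d, has_latin_trade d (k * 7)} ->
      has_latin_trade (sumn dl) (o * (k * 7))) -> 0 < k -> P k -> P (o * k).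
  move=> prod k0 Pk c cE; have [c14|c14] := ltnP c 14; first by apply: small; lia.
  by rewrite -mulnA; apply: (@latin_trade_extend 5) => //; lia.
apply: odd_four_ind.
- by move=> c cE; apply: small; lia.
- move=> c cE; have [c14|c14] := ltnP c 14; first by apply: small; lia.
  have -> : c = 14 by lia.
  exact: latin_square_trade.
- by move=> k; apply: step => dl; apply: four_product_trade.
- by move=> o k oo; apply: step => dl; apply: odd_product_trade.
Qed.

Lemma latin_trade_large d m : 14 <= d -> d ^ 2 <= m -> has_latin_trade d m.
Proof.
move=> d14 dm; have {}dm : 14 * d <= m by nia.
(* A multiple of 7 that is at least [d] and congruent to [m] modulo 5. *)
pose y := d %/ 35 * 5 + 5 + (3 * m) %% 5.
(* As 3 inverts 7 modulo 5, [y * 7] is congruent to [m]; it is at most [d + 63], which leaves at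
   least [d] for the multiple of 5. *)
have -> : m = (m - y * 7) %/ 5 * 5 + y * 7 by rewrite /y; lia.
apply: has_latin_trade_sum; first by apply: latin_trade_mul5; rewrite /y; lia.
by apply: latin_trade_mul7; rewrite /y; lia.
Qed.

Theorem theorem1p8 (d m : nat) (V : finType) :
  4 <= d -> d <= m -> #|V| = 3 * m ->
  (d = 4 /\ m <> 6 /\ m <> 7 /\ m <> 11) \/
  (d = 5 /\ m <> 6) \/
  (6 <= d <= 13) \/
  d = 15 \/
  d ^ 2 <= m \/
  (5 %| m /\ m <> 30) \/
  (7 %| m /\ ~ (m = 7 /\ d = 4) /\ m <> 42) ->
  exists (vol : nat) (T : 'I_3 -> {set {set V}}),
    steiner_trade T (3 * m) 3 2 vol /\ homogeneous T d.
Proof.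
move=> d4 dm cV cases; apply: latin_steiner_trade => //; first by lia.
have [d14|d14] := ltnP d 14.
  apply: latin_trade_degree_lt14; rewrite ?d4 // => dE; subst d; last by lia.
  (* With [d = 4], each case that allows this degree rules out the orders 6, 7 and 11. *)
  by case: cases => [|[|[|[|[|[[]|[]]]]]]]; split; lia.
case: cases => [|[|[|[d15|[/(latin_trade_large d14)|[[/dvdnP[n mE] _]|[/dvdnP[n mE] _]]]]]]] //; try by lia.
- by apply: latin_trade_small; rewrite // d15 orbT.
- by rewrite mE; apply: latin_trade_mul5; lia.
- by rewrite mE; apply: latin_trade_mul7; lia.
Qed.
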